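(* Let $(X,\|\cdot\|)$ be a real reflexive Banach space with dual $X^*$, let $f:X\to\mathbb{R}$ be fully Legendre, let $A:X\to 2^{X^*}$ be maximally monotone, and let $\lambda>0$. Suppose that both $\nabla f:X\to X^*$ and $(\nabla f+\lambda A)^{-1}:X^*\to X$ are continuous. For each pair $(x,\eta)\in X\times X^*$, denote by $(\widetilde{y}(x,\eta),\widetilde{\xi}(x,\eta))$ the unique pair $(y,\xi)\in X\times X^*$ satisfying $$\xi\in A(y),\qquad \eta=\xi+\frac{1}{\lambda}\left(\nabla f(y)-\nabla f(x)\right).$$ Then $\widetilde{y}:X\times X^*\to X$ and $\widetilde{\xi}:X\times X^*\to X^*$ are continuous functions.
   Context: A function $f:X\to(-\infty,\infty]$ on a real reflexive Banach space $X$ is called fully Legendre if it is lower semicontinuous, convex and Gâteaux differentiable (hence finite) on all of $X$, and its convex conjugate $f^*:X^*\to(-\infty,\infty]$, $f^*(x^* )=\sup\{\langle x^*,x\rangle-f(x):x\in X\}$, is Gâteaux differentiable (hence finite) on all of $X^*$. Here $\langle x^*,x\rangle=x^*(x)$ and $\nabla f$ is the Gâteaux derivative. A set-valued operator $A:X\to 2^{X^*}$ is monotone if $\langle x_1^*-x_2^*,x_1-x_2\rangle\ge 0$ whenever $x_1^*\in Ax_1$, $x_2^*\in Ax_2$; it is maximally monotone if its graph is not properly contained in the graph of another monotone operator. For $B:X\to 2^{X^*}$, $B^{-1}(w)=\{x\in X:w\in Bx\}$. Sums of sets are Minkowski sums (empty if one summand is empty), and $(A+B)x=Ax+Bx$,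 $(\lambda A)(x)=\lambda A(x)$. Under the assumptions here, $(\nabla f+\lambda A)^{-1}(w)$ is a singleton for every $w\in X^*$ (identified with its element), and the pair $(y,\xi)$ in the claim exists and is unique for all $(x,\eta)$. Continuity is with respect to the norm topologies. *)

(* Defs.v *)
From HB Require Import structures.
From mathcomp Require Import all_boot all_order all_algebra.
From mathcomp Require Import all_classical all_reals all_analysis.

Set Implicit Arguments.
Unset Strict Implicit.
Unset Printing Implicit Defensive.
Import Order.TTheory GRing.Theory Num.Theory.
Import numFieldNormedType.Exports.

Local Open Scope classical_set_scope.
Local Open Scope ring_scope.

(** * The topological dual of a normed space, with the operator norm *)

Section dual_space.
Context {R : realType} (V : normedModType R).

Definition continuous_linear_form : {pred V -> R^o} :=
  [pred u | `[< linear (u : V -> R^o) /\ continuous (u : V -> R^o) >]].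

Record dual := Dual {
  dual_fun :> V -> R^o ;
  dual_funP : dual_fun \in continuous_linear_form }.

HB.instance Definition _ := [isSub for dual_fun].
HB.instance Definition _ := [Choice of dual by <:].

Lemma continuous_linear_form_submod : submod_closed continuous_linear_form.
Proof.
split.
- apply/asboolP; split => [k x y|x].
    have E z : (0 : V -> R^o) z = 0 by [].
    by rewrite !E scaler0 addr0.
  exact: cvg_cst.
- move=> k u v /asboolP[lu cu] /asboolP[lv cv].
  apply/asboolP; split.
    move=> a x y; have E z : (k *: u + v) z = k *: u z + v z by [].
    by rewrite !E lu lv !scalerDr !scalerA mulrC addrACA.
  by move=> x; apply: cvgD; [apply: cvgZr; exact: cu|exact: cv].
Qed.

HB.instance Definition _ :=
  GRing.isSubmodClosed.Build _ _ continuous_linear_form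
    continuous_linear_form_submod.
HB.instance Definition _ := [SubChoice_isSubLmodule of dual by <:].

Lemma dual_linear (u : dual) : linear (u : V -> R^o).
Proof. by case: u => u /= /asboolP[]. Qed.

Lemma dual_continuous (u : dual) : continuous (u : V -> R^o).
Proof. by case: u => u /= /asboolP[]. Qed.

HB.instance Definition _ (u : dual) :=
  GRing.isLinear.Build R V R^o *:%R (u : V -> R^o) (dual_linear u).

Lemma dual_eqP (u v : dual) : (forall x, u x = v x) -> u = v.
Proof. by move=> uv; apply/val_inj/funext. Qed.

Definition dual_norm (u : dual) : R := sup [set `|u x| | x in [set x | `|x| <= 1]].

Lemma dual_norm_has_sup (u : dual) :
  has_sup [set `|u x| | x in [set x | `|x| <= 1]].
Proof.
split; first by exists `|u 0|, 0 => //=; rewrite normr0.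
have /linear_boundedP /pinfty_ex_gt0[M M0 uM] :=
  continuous_linear_bounded 0 (@dual_continuous u 0).
exists M => _ [x /= x1 <-]; apply: (le_trans (uM x)).
by rewrite ler_piMr// ltW.
Qed.

Lemma dual_norm_ub (u : dual) x : `|x| <= 1 -> `|u x| <= dual_norm u.
Proof.
by move=> x1; apply: ub_le_sup; [case: (dual_norm_has_sup u)|exists x].
Qed.

Lemma dual_norm_ge0 (u : dual) : 0 <= dual_norm u.
Proof.
by apply: (le_trans (normr_ge0 (u 0))); apply: dual_norm_ub; rewrite normr0.
Qed.

Lemma dual_norm_le (u : dual) M :
  (forall x, `|x| <= 1 -> `|u x| <= M) -> dual_norm u <= M.
Proof.
move=> uM; apply: ge_sup; first by case: (dual_norm_has_sup u).
by move=> _ [x /= x1 <-]; exact: uM.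
Qed.

Lemma dual_norm_bound (u : dual) x : `|u x| <= dual_norm u * `|x|.
Proof.
have [->|x0] := eqVneq x 0; first by rewrite linear0 !normr0 mulr0.
have nx : 0 < `|x| by rewrite normr_gt0.
have := @dual_norm_ub u (`|x|^-1 *: x).
rewrite linearZ/= !normrZ normfV normr_id mulVf ?gt_eqF// => /(_ (lexx _)).
by rewrite ler_pdivrMl// mulrC.
Qed.

Let dual_norm_triangle (u v : dual) :
  dual_norm (u + v) <= dual_norm u + dual_norm v.
Proof.
apply: dual_norm_le => x x1; apply: (le_trans (ler_normD (u x) (v x))).
by apply: lerD; exact: dual_norm_ub.
Qed.

Let dual_normZ_le (k : R) (u : dual) : dual_norm (k *: u) <= `|k| * dual_norm u.
Proof.
apply: dual_norm_le => x x1; rewrite (normrZ k (u x)).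
by apply: ler_wpM2l => //; exact: dual_norm_ub.
Qed.

Let dual_normZ (k : R) (u : dual) : dual_norm (k *: u) = `|k| * dual_norm u.
Proof.
apply/eqP; rewrite eq_le dual_normZ_le/=.
have [->|k0] := eqVneq k 0; first by rewrite normr0 mul0r dual_norm_ge0.
rewrite -ler_pdivlMl ?normr_gt0// -normfV.
by have := dual_normZ_le k^-1 (k *: u); rewrite scalerA mulVf// scale1r.
Qed.

Let dual_norm_eq0 (u : dual) : dual_norm u = 0 -> u = 0.
Proof.
move=> u0; apply: dual_eqP => x; apply/eqP; rewrite -normr_le0.
by apply: (le_trans (dual_norm_bound u x)); rewrite u0 mul0r.
Qed.

HB.instance Definition _ := Lmodule_isNormed.Build R dual
  dual_norm_triangle dual_normZ dual_norm_eq0.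

End dual_space.

(** Surjectivity of the canonical map from [X] into its bidual. *)
Definition reflexive_space {R : realType} (X : normedModType R) : Prop :=
  forall phi : dual (dual X), exists x : X, forall u : dual X, phi u = u x.

(** * Convex functions and Gateaux derivatives *)

Section legendre.
Context {R : realType}.

Definition is_gateaux {V : normedModType R} (f : V -> R) (x : V) (u : dual V)
    : Prop :=
  forall h : V, is_derive x h (f : V -> R^o) (u h).

Definition gateaux_differentiable {V : normedModType R} (f : V -> R) : Prop :=
  forall x, exists u : dual V, is_gateaux f x u.

(** The Gateaux derivative is unique when it exists; the value is [0] at points
    where [f] is not Gateaux differentiable. *)
Definition gateaux_derivative {V : normedModType R} (f : V -> R) (x : V)
    : dual V :=
  xget 0 [set u | is_gateaux f x u].

Definition conjugate {V : normedModType R} (f : V -> R) (u : dual V) : \bar R :=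
  ereal_sup [set (u x - f x)%:E | x in [set: V]].

(** Gateaux differentiability on the whole space forces finiteness, so [f] is
    taken real-valued, and the conjugate is asked to be the extension of a
    real-valued Gateaux differentiable function. *)
Definition fully_legendre {X : normedModType R} (f : X -> R) : Prop :=
  [/\ lower_semicontinuous (EFin \o f),
      convex_function [set: X] (f : X -> R^o),
      gateaux_differentiable f &
      exists2 g : dual X -> R,
        conjugate f = EFin \o g & gateaux_differentiable g].

End legendre.

(** * Set-valued operators *)

Section operators.
Context {R : realType}.

Definition graph {U V : Type} (A : U -> set V) : set (U * V) :=
  [set p | A p.1 p.2].

Definition op_inv {U V : Type} (A : U -> set V) (w : V) : set U :=
  [set x | A x w].

Definition op_add {U : Type} {V : zmodType} (A B : U -> set V) (x : U) : set V :=
  [set a + b | a in A x & b in B x].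

Definition op_scale {U : Type} {V : lmodType R} (k : R) (A : U -> set V)
    (x : U) : set V :=
  [set k *: a | a in A x].

(** A set-valued operator with singleton values is identified with the map
    sending a point to the unique element of its value; this says that the map
    obtained in this way is continuous. *)
Definition is_continuous_map {U V : topologicalType} (A : U -> set V) : Prop :=
  exists2 g : U -> V, forall x, A x = [set g x] & continuous g.

Definition monotone_op {X : normedModType R} (A : X -> set (dual X)) : Prop :=
  forall (x1 x2 : X) (u1 u2 : dual X),
    A x1 u1 -> A x2 u2 -> 0 <= (u1 - u2) (x1 - x2).

Definition maximally_monotone {X : normedModType R} (A : X -> set (dual X))
    : Prop :=
  monotone_op A /\
  forall B : X -> set (dual X), monotone_op B -> ~ (graph A `<` graph B).

End operators.

(* Main.v *)
Require Import Defs.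
From mathcomp Require Import all_boot all_order all_algebra.
From mathcomp Require Import all_classical all_reals all_analysis.
Import Order.TTheory GRing.Theory Num.Theory.
Import numFieldNormedType.Exports.
Local Open Scope classical_set_scope.
Local Open Scope ring_scope.

(* Multiplying the equation by [lambda] turns the system into
   [lambda eta + grad f x \in (grad f + lambda A) y], so [y] is the resolvent at
   [lambda eta + grad f x], and the equation then gives [xi]; both are compositions
   of continuous maps. *)

Theorem proposition6p1 (R : realType) (X : completeNormedModType R)
    (X_refl : reflexive_space X)
    (f : X -> R) (f_leg : fully_legendre f)
    (A : X -> set (dual X)) (A_max : maximally_monotone A)
    (lambda : R) (lambda_gt0 : 0 < lambda)
    (grad_cont : continuous (gateaux_derivative f))
    (resolvent_cont : is_continuous_map
      (op_inv (op_add (fun x => [set gateaux_derivative f x])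
                      (op_scale lambda A)))) :
  exists (ytilde : X * dual X -> X) (xitilde : X * dual X -> dual X),
    [/\ forall (x : X) (eta : dual X) (y : X) (xi : dual X),
          (A y xi /\
           eta = xi + lambda^-1 *:
                   (gateaux_derivative f y - gateaux_derivative f x)) <->
          (y = ytilde (x, eta) /\ xi = xitilde (x, eta)),
        continuous ytilde &
        continuous xitilde].
Proof.
have l0 : lambda != 0 by rewrite gt_eqF.
have [J JE J_cont] := resolvent_cont.
set D := gateaux_derivative f in JE grad_cont *.
(* Uniqueness half: the hypothesis puts [y] in the resolvent set at [w], which [JE] identifies with
   the singleton of [J w]. *)
have resolventP y xi w :
    w = D y + lambda *: xi -> A y xi -> y = J w.
  move=> -> Axi.
  have : [set J (D y + lambda *: xi)] y; last by [].
  by rewrite -JE; exists (D y) => //; exists (lambda *: xi) => //; exists xi.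
(* Existence half: [J w] lies in its own singleton, and unfolding the operator sum there produces
   [xi]. *)
have J_resolvent w : exists2 xi, A (J w) xi & w = D (J w) + lambda *: xi.
  have : [set J w] (J w) by [].
  by rewrite -JE => -[_ ->] [_ [xi Axi <-]] wE; exists xi; rewrite ?wE.
pose yt (p : X * dual X) := J (lambda *: p.2 + D p.1).
(* The equation solved for [xi], so it holds for [yt] and [xt] by construction. *)
pose xt (p : X * dual X) := p.2 - lambda^-1 *: (D (yt p) - D p.1).
have D1_cont : continuous (fun p : X * dual X => D p.1).
  by move=> p; apply: continuous_comp; [exact: cvg_fst|exact: grad_cont].
have yt_cont : continuous yt.
  move=> p; apply: (@continuous_comp _ _ _
    (fun p : X * dual X => lambda *: p.2 + D p.1) J); last exact: J_cont.
  by apply: cvgD; [apply: cvgZl_tmp; apply: cvg_snd|exact: D1_cont].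
exists yt, xt; split => [x eta y xi|//|].
- split => [[Axi etaE]|[-> ->]].
    have yE : y = yt (x, eta).
      apply: resolventP Axi => /=.
      by rewrite etaE scalerDr scalerA mulfV// scale1r addrA subrK addrC.
    by split => //; rewrite /xt -yE /= etaE addrK.
  split; last by rewrite /xt /= subrK.
  (* Only membership in [A] remains: [xt (x, eta)] is shown to equal the element [xi'] of [A] at the
     resolvent point. *)
  have [xi' Axi' wE] := J_resolvent (lambda *: eta + D x).
  suff -> : xt (x, eta) = xi' by [].
  (* Naming the resolvent point keeps the rewriting by [wE] out of the argument of [J]. *)
  rewrite /xt /yt /=; set y' := J _ in wE *.
  apply: (scalerI l0).
  rewrite scalerBr scalerA mulfV// scale1r opprB addrA wE.
  by rewrite addrAC subrr add0r.
- move=> p; apply: cvgB; first exact: cvg_snd.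
  apply: cvgZl_tmp; apply: cvgB; last exact: D1_cont.
  by apply: (@continuous_comp _ _ _ yt D); [exact: yt_cont|exact: grad_cont].
Qed.
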